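(* Let $C\subseteq\mathbb{R}^{n+1}$ be a proper open cone with base-point $b\in C$. Let $x,y\in\partial C\setminus\{0\}$, $S\in\mathcal{T}(\tau(C,x))$, $T\in\mathcal{T}(\tau(C,y))$, $p\in S$, $q\in T$, and suppose that $g=r_{C,x}+f_{S,p}|_C$ and $h=r_{C,y}+f_{T,q}|_C$ are Busemann points of the Hilbert geometry on $C$. Then \[\delta(g,h)=\begin{cases} d_F(x,y)+d_S(p,q) & \text{if $x$ and $y$ have the same face $F$, and $S=T$,}\\ \infty & \text{otherwise.}\end{cases}\]
   Context: An open cone $C\subseteq\mathbb{R}^{n+1}$ is a nonempty open convex set with $\lambda C\subseteq C$ for all $\lambda>0$; it is proper if $\overline C\cap(-\overline C)=\{0\}$. For a convex cone $K$ (e.g. an open cone, or a face of $\overline C$) and $x,y$ with $x$ in the relative interior of $K$, let $M(y/x;K)=\inf\{\lambda>0\colon \lambda x-y\in\overline K\}$. Funk metric: $\mathcal F_K(x,y)=\log M(x/y;K)$; reverse-Funk metric: $\mathcal{RF}_K(x,y)=\log M(y/x;K)$; Hilbert's projective metric $d_K(x,y)=\mathcal F_K(x,y)+\mathcal{RF}_K(x,y)$ (for $x,y$ in the relative interior of $K$). For $z\in\partial C$ the open tangent cone is $\tau(C,z)=\{\lambda(w-z)\colon \lambda>0,\ w\in C\}$. For a collection $\Pi$ of open cones let $\Gamma(\Pi)=\{\tau(T,z)\colon T\in\Pi,\ z\in\partial T\}$, and $\mathcal T(C)=\bigcup_{k=1}^{n}\Gamma^k(\{C\})$ (each cone in $\mathcal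 T(C)$ contains $C$). For an open cone $T\supseteq C$ and $p\in T$, $f_{T,p}(w)=\mathcal F_T(w,p)-\mathcal F_T(b,p)$; for $z\in\overline C$, $r_{C,z}(w)=\mathcal{RF}_C(w,z)-\mathcal{RF}_C(b,z)$ for $w\in C$. The face of $x\in\overline C$ is the set of $y\in\overline C$ such that the line through $x$ and $y$ contains an open segment $I\subseteq\overline C$ with $x\in I$; $d_F$ is Hilbert's projective metric of this face $F$ (a convex cone) on its relative interior. Horofunctions of the Hilbert geometry on $C$: for $z\in C$ let $\phi_z(w)=d_C(w,z)-d_C(b,z)$, $w\in C$; give functions on $C$ the topology of uniform convergence on compact sets. A path $\gamma\colon T_0\to C$ ($T_0\subseteq\mathbb{R}$ unbounded, $0\in T_0$) is an almost-geodesic if for every $\epsilon>0$ there is $M$ with $|d_C(\gamma(0),\gamma(s))+d_C(\gamma(s),\gamma(t))-t|<\epsilon$ for all $s,t\in T_0$, $t\geq s\geq M$. A Busemann point is a limit $\xi=\lim_{t\to\infty}\phi_{\gamma(t)}$ along an almost-geodesic $\gamma$, not itself of the form $\phi_z$ up to this topology. The detour cost of Busemann points $\xi,\eta$ is $H(\xi,\eta)=\inf_\gamma\liminf_{t\to\infty}\big(d_C(b,\gamma(t))+\eta(\gamma(t))\big)$, the infimum over all paths $\gamma$ with $\phi_{\gamma(t)}\to\xi$, and the detour metric is $\delta(\xi,\eta)=H(\xi,\eta)+H(\eta,\xi)$. *)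

(* Defs.v *)
From HB Require Import structures.
From mathcomp Require Import all_boot all_order all_algebra.
From mathcomp Require Import all_classical all_reals all_analysis.
Set Implicit Arguments. Unset Strict Implicit. Unset Printing Implicit Defensive.
Import Order.TTheory GRing.Theory Num.Theory.
Import numFieldNormedType.Exports.
Local Open Scope classical_set_scope.
Local Open Scope ring_scope.

Definition pt (R : realType) (n : nat) := 'rV[R]_(n.+1).

Section Defs.
Variables (R : realType) (n : nat).
Local Notation V := (pt R n).

Definition convex_set (C : set V) :=
  forall x y, C x -> C y -> forall t : R, 0 <= t <= 1 -> C (t *: x + (1 - t) *: y).

Definition open_cone (C : set V) :=
  [/\ C !=set0, open C, convex_set C & forall (l : R) x, 0 < l -> C x -> C (l *: x)].

Definition proper_cone (C : set V) :=
  closure C `&` [set - x | x in closure C] = [set 0].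

(* topological boundary of an open set *)
Definition bdry (C : set V) := closure C `\` C.

Definition Mratio (K : set V) (a c : V) : R :=
  inf [set l : R | 0 < l /\ closure K (l *: c - a)].

Definition funk (K : set V) (x y : V) : R := ln (Mratio K x y).
Definition rfunk (K : set V) (x y : V) : R := ln (Mratio K y x).
Definition hilbert (K : set V) (x y : V) : R := funk K x y + rfunk K x y.

Definition tcone (C : set V) (z : V) : set V :=
  [set v | exists (l : R) w, [/\ 0 < l, C w & v = l *: (w - z)]].

Definition Gamma (Pi : set (set V)) : set (set V) :=
  [set U | exists T z, [/\ Pi T, bdry T z & U = tcone T z]].

Definition iterGamma (k : nat) (C : set V) : set (set V) := iter k Gamma [set C].

Definition Tset (C : set V) : set (set V) :=
  [set U | exists k : nat, (1 <= k <= n)%N /\ iterGamma k C U].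

Definition fbus (T : set V) (b p : V) (w : V) : R := funk T w p - funk T b p.
Definition rbus (C : set V) (b z : V) (w : V) : R := rfunk C w z - rfunk C b z.
Definition horo (C : set V) (b z : V) (w : V) : R := hilbert C w z - hilbert C b z.

Definition face (C : set V) (x : V) : set V :=
  [set y | closure C y /\
     (y = x \/ exists e : R, 0 < e /\
        forall s : R, `|s| < e -> closure C (x + s *: (y - x)))].

Definition cpath (C : set V) (T0 : set R) (gam : R -> V) :=
  (forall M : R, exists t, T0 t /\ M <= t) /\ (forall t, T0 t -> C (gam t)).

Definition conv_horo (C : set V) (b : V) (T0 : set R) (gam : R -> V) (xi : V -> R) :=
  forall K : set V, compact K -> K `<=` C -> forall e : R, 0 < e ->
    exists M : R, forall t, T0 t -> M <= t -> forall w, K w ->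
      `|horo C b (gam t) w - xi w| < e.

Definition almost_geodesic (C : set V) (T0 : set R) (gam : R -> V) :=
  [/\ cpath C T0 gam, T0 0 &
    forall e : R, 0 < e -> exists M : R, forall s t, T0 s -> T0 t -> M <= s -> s <= t ->
      `|hilbert C (gam 0) (gam s) + hilbert C (gam s) (gam t) - t| < e].

Definition busemann (C : set V) (b : V) (xi : V -> R) :=
  (exists T0 gam, almost_geodesic C T0 gam /\ conv_horo C b T0 gam xi) /\
  ~ (exists z, C z /\ forall w, C w -> horo C b z w = xi w).

Definition path_liminf (T0 : set R) (f : R -> R) : \bar R :=
  ereal_sup [set ereal_inf [set (f t)%:E | t in [set t | T0 t /\ M <= t]] | M in [set: R]].

Definition detour (C : set V) (b : V) (xi eta : V -> R) : \bar R :=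
  ereal_inf [set v | exists T0 gam, [/\ cpath C T0 gam, conv_horo C b T0 gam xi &
     v = path_liminf T0 (fun t => hilbert C b (gam t) + eta (gam t))]].

Definition detour_metric (C : set V) (b : V) (xi eta : V -> R) : \bar R :=
  (detour C b xi eta + detour C b eta xi)%E.

End Defs.

(* Main.v *)
Require Import Defs.
From HB Require Import structures.
From mathcomp Require Import all_boot all_order all_algebra.
From mathcomp Require Import all_classical all_reals all_analysis.
From mathcomp Require Import ring lra.
Import Order.TTheory GRing.Theory Num.Theory.
Import numFieldNormedType.Exports.
Local Open Scope classical_set_scope.
Local Open Scope ring_scope.

(* Write M(a/c; K) for [Mratio K a c].  As a Busemann point, g satisfies
   d(b, gamma(s)) + g(gamma(s)) -> 0 along its almost-geodesic, and h is 1-Lipschitz;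
   hence H(g, h) = sup_C (h - g).  The triangle inequalities for M bound h - g from
   above when y <= l x for some l and S = T.
   Conversely, a bound on h - g says that
     M(y/w; C) M(w/q; T) <= k M(x/w; C) M(w/p; S)   for all w in C.
   Letting w = x + e u with e -> 0 gives -x in the closure of T, M(y/x; C) finite and
     M(y/x; C) M(u/q; T) <= k M(u/p; S)   for all u in the tangent cone of C at x;
   the same substitution u = z + e v carries the inequality along the chain of tangent
   cones up to S, and shows S included in T.  At u = p this is the lower bound, and if
   both detour costs are finite then S = T and x, y dominate each other, i.e. have the
   same face. *)

Local Ltac vring := apply/rowP => ?; rewrite !mxE; ring.
Local Ltac vfield := apply/rowP => ?; rewrite !mxE; field.

(** * Open cones and their closures, the ratio M, tangent cones *)

Section Cones.
Set Implicit Arguments.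
Unset Strict Implicit.
Variables (R : realType) (n : nat).
Local Notation V := 'rV[R]_(n.+1).
Implicit Types (A C K S T : set V) (a b c d u v w x y z p q : V).

Lemma cvg_line v u : v + e *: u @[e --> (0 : R)^'+] --> v.
Proof.
rewrite -[X in _ --> X]addr0; apply: cvgD; first exact: cvg_cst.
by rewrite -[X in _ --> X](scale0r u); apply: cvgZr_tmp; apply: cvg_within.
Qed.

Lemma closure_line A v u (e0 : R) : 0 < e0 ->
  (forall e, 0 < e -> e < e0 -> closure A (v + e *: u)) -> closure A v.
Proof.
move=> e0_gt0 Av; apply: (closed_cvg (closure A) _ _ v (@cvg_line v u)).
  exact: closed_closure.
near=> e; apply: Av; first by near: e; exact: nbhs_right_gt.
by near: e; apply: nbhs_right_lt.
Unshelve. all: by end_near. Qed.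

Lemma open_absorb K k v : open K -> K k -> exists2 e : R, 0 < e & K (k + e *: v).
Proof.
move=> Ko Kk.
have /filter_ex [e [e_gt0 Ke]] : \forall e \near (0 : R)^'+, 0 < e /\ K (k + e *: v).
  near=> e; split; first by near: e; exact: nbhs_right_gt.
  near: e; apply: (@cvg_line k v); exact: open_nbhs_nbhs.
by exists e.
Unshelve. all: by end_near. Qed.

Lemma continuous_shift u : continuous (fun v : V => v + u).
Proof.
by move=> x; apply: (@cvgD R V V (nbhs x) _ id (cst u)); [exact: cvg_id|exact: cvg_cst].
Qed.

Lemma continuous_shift_neg u v : continuous (fun w : V => u + (v - w)).
Proof.
move=> x; apply: (@cvgD R V V (nbhs x) _ (cst u) (fun w => v - w)); first exact: cvg_cst.
by apply: (@cvgB R V V (nbhs x) _ (cst v) id); [exact: cvg_cst|exact: cvg_id].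
Qed.

Lemma coneZ K (l : R) v : open_cone K -> 0 < l -> K v -> K (l *: v).
Proof. by case=> _ _ _ KZ l_gt0; apply: KZ. Qed.

Lemma coneD K u v : open_cone K -> K u -> K v -> K (u + v).
Proof.
move=> Kc Ku Kv; have [_ _ Kx _] := Kc.
have -> : u + v = 2 *: (2^-1 *: u + (1 - 2^-1) *: v) by vfield.
by apply: coneZ => //; apply: Kx => //; apply/andP; split; lra.
Qed.

(** Approximate [v] by some [w] in [K]: openness of [K] at [u] absorbs the error [v - w]. *)
Lemma coneDcl K u v : open_cone K -> K u -> closure K v -> K (u + v).
Proof.
move=> Kc Ku Kv; have [_ Ko _ _] := Kc.
have /Kv [w [Kw Kuw]] : nbhs v [set w | K (u + (v - w))].
  apply: open_nbhs_nbhs; split; last by rewrite /= subrr addr0.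
  apply: (@open_comp _ _ (fun w => u + (v - w)) K) => // w _.
  exact: continuous_shift_neg.
have -> : u + v = u + (v - w) + w by vring.
exact: coneD.
Qed.

(** Reduces membership in the closure to an algebraic test along a single interior direction [k],
    from which the cone properties of [closure K] follow. *)
Lemma closure_coneP K k v : open_cone K -> K k ->
  closure K v <-> forall e : R, 0 < e -> K (v + e *: k).
Proof.
move=> Kc Kk; split=> [Kv e e_gt0|Kv].
  by rewrite addrC; apply: coneDcl => //; apply: coneZ.
by apply: (@closure_line _ _ k _ ltr01) => e e_gt0 _; apply: subset_closure; apply: Kv.
Qed.

Lemma closure_coneD K u v : open_cone K -> closure K u -> closure K v -> closure K (u + v).
Proof.
move=> Kc Ku Kv; have [[k Kk] _ _ _] := Kc.
apply/(closure_coneP _ Kc Kk) => e e_gt0.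
rewrite -addrA addrC; apply: coneDcl => //.
exact: (proj1 (closure_coneP _ Kc Kk) Kv).
Qed.

Lemma closure_cone0 K : open_cone K -> closure K 0.
Proof.
move=> Kc; have [[k Kk] _ _ _] := Kc.
by apply/(closure_coneP _ Kc Kk) => e e_gt0; rewrite add0r; apply: coneZ.
Qed.

Lemma closure_coneZ K (l : R) v : open_cone K -> 0 <= l -> closure K v -> closure K (l *: v).
Proof.
move=> Kc; rewrite le_eqVlt => /predU1P[<- _|l_gt0 Kv].
  by rewrite scale0r; apply: closure_cone0.
have [[k Kk] _ _ _] := Kc.
apply/(closure_coneP _ Kc Kk) => e e_gt0.
have -> : l *: v + e *: k = l *: (v + (e / l) *: k) by vfield; rewrite gt_eqF.
by apply: coneZ => //; apply: (proj1 (closure_coneP _ Kc Kk) Kv); apply: divr_gt0.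
Qed.

Lemma closure_coneN K u : open_cone K -> ~ K 0 -> K u -> ~ closure K (- u).
Proof. by move=> Kc K0 Ku /(coneDcl Kc Ku); rewrite subrr. Qed.

Lemma cone_dominates K u v : open_cone K -> K u -> exists l : R, closure K (l *: u - v).
Proof.
move=> Kc Ku; have [_ Ko _ _] := Kc.
have [e e_gt0 Ke] := open_absorb (- v) Ko Ku.
exists e^-1; apply: subset_closure.
have -> : e^-1 *: u - v = e^-1 *: (u + e *: - v) by vfield; rewrite gt_eqF.
by apply: coneZ => //; rewrite invr_gt0.
Qed.

(* Under these conditions the infimum defining [Mratio K a c] is attained and positive. *)
Definition comparable_pair K a c :=
  [/\ closure K c, ~ closure K (- a) & exists l : R, closure K (l *: c - a)].

(** The admissible [l] are positive, since otherwise [- a = (l *: c - a) + (- l) *: c] would lie in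
    the closure. They are upward closed because [c] lies in the closure, and they contain their
    infimum; hence they form the closed ray starting at [Mratio K a c]. *)
Lemma MratioP K a c : open_cone K -> comparable_pair K a c ->
  0 < Mratio K a c /\ forall l : R, closure K (l *: c - a) <-> Mratio K a c <= l.
Proof.
move=> Kc [Kcl Kna [l0 Kl0]].
pose E := [set l : R | 0 < l /\ closure K (l *: c - a)].
have pos l : closure K (l *: c - a) -> 0 < l.
  move=> Kl; rewrite ltNge; apply/negP => l_le0; apply: Kna.
  have -> : - a = (l *: c - a) + (- l) *: c by vring.
  by apply: (closure_coneD Kc Kl (closure_coneZ Kc _ Kcl)); rewrite oppr_ge0.
clear Kna; have up l l' : l <= l' -> closure K (l *: c - a) -> closure K (l' *: c - a).
  move=> ll' Kl; have -> : l' *: c - a = (l *: c - a) + (l' - l) *: c by vring.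
  by apply: (closure_coneD Kc Kl (closure_coneZ Kc _ Kcl)); rewrite subr_ge0.
have El l : closure K (l *: c - a) -> E l by move=> Kl; split; [exact: pos|].
have Elb : has_lbound E by exists 0 => l [/ltW].
have Einf : has_inf E by split; [exists l0; exact: El|].
have Kinf : closure K (Mratio K a c *: c - a).
  apply: (@closure_line _ _ c _ ltr01) => e e_gt0 _.
  have [l [_ Kl] lt_l] := inf_adherent e_gt0 Einf.
  have -> : Mratio K a c *: c - a + e *: c = (Mratio K a c + e) *: c - a.
    by rewrite scalerDl addrAC.
  by apply: up Kl; apply: ltW.
split=> [|l]; first exact: pos.
by split=> [/El|/up]; [apply: ge_inf | apply].
Qed.

(** Allows the ratio over a face, in general not an open cone, to be compared with the ratio over
    [C]. *)
Lemma eq_Mratio K K' a c :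
  (forall l : R, 0 < l -> closure K (l *: c - a) <-> closure K' (l *: c - a)) ->
  Mratio K a c = Mratio K' a c.
Proof.
by move=> KK'; congr inf; apply/seteqP; split=> l [l_gt0 Kl]; split=> //; apply/KK'.
Qed.

Lemma Mratio_gt0 K a c : open_cone K -> comparable_pair K a c -> 0 < Mratio K a c.
Proof. by move=> Kc /(MratioP Kc)[]. Qed.

Lemma Mratio_le K a c (l : R) : open_cone K -> comparable_pair K a c ->
  closure K (l *: c - a) -> Mratio K a c <= l.
Proof. by move=> Kc /(MratioP Kc)[_ H] /H. Qed.

Lemma Mratio_closure K a c (l : R) : open_cone K -> comparable_pair K a c ->
  Mratio K a c <= l -> closure K (l *: c - a).
Proof. by move=> Kc /(MratioP Kc)[_ H] /H. Qed.

Lemma comparable_pair_cone K a c : open_cone K -> ~ K 0 -> K a -> K c ->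
  comparable_pair K a c.
Proof.
move=> Kc K0 Ka Kcc; split; [exact: subset_closure|exact: closure_coneN|].
exact: cone_dominates.
Qed.

Lemma scaler_chain (l m : R) a c d :
  (l * m) *: d - a = l *: (m *: d - c) + (l *: c - a).
Proof. by vring. Qed.

Lemma comparable_pair_trans K a c d : open_cone K ->
  comparable_pair K a c -> comparable_pair K c d -> comparable_pair K a d.
Proof.
move=> Kc Kac Kcd; have [_ Ka _] := Kac; have [Kd _ _] := Kcd.
split; [exact: Kd|exact: Ka|exists (Mratio K a c * Mratio K c d)].
rewrite (scaler_chain _ _ a c d).
have Mac := Mratio_closure Kc Kac (lexx _); have Mcd := Mratio_closure Kc Kcd (lexx _).
exact: (closure_coneD Kc (closure_coneZ Kc (ltW (Mratio_gt0 Kc Kac)) Mcd) Mac).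
Qed.

Lemma Mratio_triangle K a c d : open_cone K ->
  comparable_pair K a c -> comparable_pair K c d ->
  Mratio K a d <= Mratio K a c * Mratio K c d.
Proof.
move=> Kc Kac Kcd; apply: (Mratio_le Kc (comparable_pair_trans Kc Kac Kcd)).
rewrite (scaler_chain _ _ a c d).
have Mac := Mratio_closure Kc Kac (lexx _); have Mcd := Mratio_closure Kc Kcd (lexx _).
exact: (closure_coneD Kc (closure_coneZ Kc (ltW (Mratio_gt0 Kc Kac)) Mcd) Mac).
Qed.

Lemma Mratio_refl K a : open_cone K -> ~ K 0 -> K a -> Mratio K a a = 1.
Proof.
move=> Kc K0 Ka; have Kaa := comparable_pair_cone Kc K0 Ka Ka.
apply/eqP; rewrite eq_le; apply/andP; split.
  by apply: Mratio_le; rewrite ?scale1r ?subrr //; apply: closure_cone0.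
rewrite leNgt; apply/negP => lt1.
have /(closure_coneN Kc K0 Ka) : closure K (- a); last by [].
have := Mratio_closure Kc Kaa (lexx _).
move: (Mratio K a a) lt1 => m lt1 Km.
(* For [m < 1] the vector [m *: a - a] is a negative multiple of [a]. *)
have -> : - a = (1 - m)^-1 *: (m *: a - a) by vfield; rewrite subr_eq0 gt_eqF.
by apply: (closure_coneZ Kc _ Km); rewrite invr_ge0 subr_ge0 ltW.
Qed.

Lemma MratioS A K a c : open_cone A -> open_cone K -> A `<=` K ->
  comparable_pair A a c -> comparable_pair K a c -> Mratio K a c <= Mratio A a c.
Proof.
move=> Ac Kc AK Aac Kac; apply: Mratio_le => //.
by apply: (closureS AK); apply: Mratio_closure.
Qed.

(** As [A] is a cone, its tangent cone at [z] is the sum of [A] and the line spanned by [z]. *)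
Lemma tconeP A z v : open_cone A -> closure A z ->
  tcone A z v <-> exists m : R, A (v + m *: z).
Proof.
move=> Ac Az; split=> [[l [w [l_gt0 Aw ->]]]|[m Am]].
  exists l; have -> : l *: (w - z) + l *: z = l *: w by vring.
  exact: coneZ.
(* Enlarging [m] adds a nonnegative multiple of [z], which keeps the point in [A]; so the
   coefficient may be taken positive. *)
pose l := Num.max m 1; have l_gt0 : 0 < l by rewrite lt_max ltr01 orbT.
exists l, (l^-1 *: (v + l *: z)); split=> //; last by vfield; rewrite gt_eqF.
apply: coneZ; rewrite ?invr_gt0 //.
have -> : v + l *: z = (v + m *: z) + (l - m) *: z by vring.
apply: coneDcl => //; apply: closure_coneZ => //.
by rewrite subr_ge0 le_max lexx.
Qed.

Lemma open_cone_tcone A z : open_cone A -> closure A z -> open_cone (tcone A z).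
Proof.
move=> Ac Az; have [[a Aa] Ao Ax AZ] := Ac; split.
- by exists a; apply/tconeP => //; exists 0; rewrite scale0r addr0.
- have -> : tcone A z = \bigcup_(m in [set: R]) [set v | A (v + m *: z)].
    apply/seteqP; split=> v; first by move=> /(tconeP _ Ac Az)[m Am]; exists m.
    by move=> [m _ Am]; apply/tconeP => //; exists m.
  apply: bigcup_open => m _.
  apply: (@open_comp _ _ (fun v => v + m *: z) A) => // w _.
  exact: continuous_shift.
- move=> u v /(tconeP _ Ac Az)[m Am] /(tconeP _ Ac Az)[k Ak] t t01.
  apply/tconeP => //; exists (t * m + (1 - t) * k).
  suff -> : t *: u + (1 - t) *: v + (t * m + (1 - t) * k) *: z =
    t *: (u + m *: z) + (1 - t) *: (v + k *: z) by apply: Ax.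
  by vring.
- move=> l v l_gt0 /(tconeP _ Ac Az)[m Am]; apply/tconeP => //.
  exists (l * m); rewrite -scalerA -scalerDr; exact: coneZ.
Qed.

(** Otherwise some [m *: z] lies in [A]; adding a large multiple of [z] gives a positive multiple of
    [z] in [A], hence [z] itself. *)
Lemma tcone_not0 A z : open_cone A -> bdry A z -> ~ tcone A z 0.
Proof.
move=> Ac [Az nAz] /(tconeP _ Ac Az)[m]; rewrite add0r => Am; apply: nAz.
have -> : z = (1 + `|m|)^-1 *: (m *: z + (1 + `|m| - m) *: z).
  by vfield; rewrite gt_eqF // ltr_pwDl.
apply: coneZ; rewrite ?invr_gt0 ?ltr_pwDl //; apply: coneDcl => //.
by apply: closure_coneZ => //; have := ler_norm m; lra.
Qed.

Lemma subset_tcone A z : open_cone A -> closure A z -> A `<=` tcone A z.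
Proof. by move=> Ac Az v Av; apply/tconeP => //; exists 0; rewrite scale0r addr0. Qed.

Lemma closure_tconeN A z : open_cone A -> closure A z -> closure (tcone A z) (- z).
Proof.
move=> Ac Az; have [[a Aa] _ _ _] := Ac.
apply: (@closure_line _ _ a _ ltr01) => e e_gt0 _; apply: subset_closure.
apply/tconeP => //; exists 1; rewrite scale1r addrAC addNr add0r.
exact: coneZ.
Qed.

(** With [v = l *: (w - z)] and [e <= l^-1], the point [z + e *: v] is a convex combination of [w]
    and [z]. *)
Lemma tcone_near A z v : open_cone A -> tcone A z v -> closure A z ->
  exists2 e0 : R, 0 < e0 & forall e : R, 0 < e -> e <= e0 -> A (z + e *: v).
Proof.
move=> Ac [l [w [l_gt0 Aw ->]]] Az; exists l^-1; rewrite ?invr_gt0 // => e e_gt0 le_e.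
have -> : z + e *: (l *: (w - z)) = (e * l) *: w + (1 - e * l) *: z by vring.
apply: coneDcl => //; first by apply: coneZ; rewrite ?mulr_gt0.
apply: closure_coneZ => //; rewrite subr_ge0.
by rewrite -ler_pdivlMr // div1r.
Qed.

(** Both [z] and [- z] lie in the closure of [T], so [T] is stable under translation along the line
    of [z]. *)
Lemma tcone_sub A T z : open_cone A -> open_cone T -> closure A z ->
  A `<=` T -> closure T (- z) -> tcone A z `<=` T.
Proof.
move=> Ac Tc Az AT Tz v /(tconeP _ Ac Az)[m /AT Tm].
have -> : v = (v + m *: z) + (- m) *: z by vring.
apply: (coneDcl Tc Tm); have [m_ge0|/ltW m_le0] := leP 0 m.
  by rewrite scaleNr -scalerN; apply: (closure_coneZ Tc m_ge0 Tz).
by apply: (closure_coneZ Tc _ (closureS AT Az)); rewrite oppr_ge0.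
Qed.

Lemma iterGammaP (k : nat) A S : open_cone A -> ~ A 0 -> iterGamma k A S ->
  [/\ open_cone S, ~ S 0 & A `<=` S].
Proof.
move=> Ac A0; rewrite /iterGamma; elim: k S => [S|k IH S] /=.
  by move=> ->; split.
move=> [S' [z [/IH[Sc S0 AS] Sz ->]]]; have [Scl _] := Sz.
split; [exact: open_cone_tcone|exact: tcone_not0|].
by apply: (subset_trans AS); apply: subset_tcone.
Qed.

Lemma bdry_not0 C x : open_cone C -> bdry C x -> ~ C 0.
Proof.
move=> Cc [Cx nCx] C0; apply: nCx.
by rewrite -[x]add0r; apply: coneDcl.
Qed.

Lemma proper_closureN C x : proper_cone C -> closure C x -> x != 0 -> ~ closure C (- x).
Proof.
move=> Cp Cx x0 Cnx.
suff : (closure C `&` [set - v | v in closure C]) x.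
  by rewrite Cp => /eqP; rewrite (negPf x0).
by split=> //; exists (- x); rewrite ?opprK.
Qed.

End Cones.

(** * Ratio inequalities along chains of tangent cones; faces *)

Section TangentChains.
Set Implicit Arguments.
Unset Strict Implicit.
Variables (R : realType) (n : nat).
Local Notation V := 'rV[R]_(n.+1).
Local Opaque Mratio.
Implicit Types (A C S T : set V) (b u v w x y z p q : V).

(** With [- z] in the closure of [S], adding [z] cannot increase the ratio; dually, in the next
    lemma, adding [z] from the closure of [T] cannot decrease it. *)
Lemma Mratio_shift_le S p v z (e : R) : open_cone S -> ~ S 0 -> S p -> S v ->
  closure S (- z) -> 0 < e -> S (z + e *: v) ->
  Mratio S (z + e *: v) p <= e * Mratio S v p.
Proof.
move=> Sc S0 Sp Sv Sz e_gt0 Szv.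
apply: (Mratio_le Sc (comparable_pair_cone Sc S0 Szv Sp)).
have := Mratio_closure Sc (comparable_pair_cone Sc S0 Sv Sp) (lexx _).
move: (Mratio S v p) => m Sm.
have -> : (e * m) *: p - (z + e *: v) = e *: (m *: p - v) + (- z) by vring.
exact: (closure_coneD Sc (closure_coneZ Sc (ltW e_gt0) Sm) Sz).
Qed.

Lemma Mratio_shift_ge T q v z (e : R) : open_cone T -> ~ T 0 -> T q -> T v ->
  closure T z -> 0 < e -> T (z + e *: v) ->
  e * Mratio T v q <= Mratio T (z + e *: v) q.
Proof.
move=> Tc T0 Tq Tv Tz e_gt0 Tzv.
rewrite mulrC -ler_pdivlMr //; apply: (Mratio_le Tc (comparable_pair_cone Tc T0 Tv Tq)).
have := Mratio_closure Tc (comparable_pair_cone Tc T0 Tzv Tq) (lexx _).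
move: (Mratio T (z + e *: v) q) => m Tm.
have -> : (m / e) *: q - v = e^-1 *: ((m *: q - (z + e *: v)) + z).
  by vfield; rewrite gt_eqF.
by apply: (closure_coneZ Tc _ (closure_coneD Tc Tm Tz)); rewrite invr_ge0 ltW.
Qed.

(** A ratio of order [e] at [z + e *: v] puts [- z + e *: (k *: q - v)] in the closure of [T]; let
    [e] tend to 0. *)
Lemma Mratio_shift_lineality T q v z (k e0 : R) : open_cone T -> ~ T 0 -> T q -> 0 < e0 ->
  (forall e : R, 0 < e -> e < e0 ->
     T (z + e *: v) /\ Mratio T (z + e *: v) q <= e * k) ->
  closure T (- z).
Proof.
move=> Tc T0 Tq e0_gt0 H.
apply: (@closure_line _ _ _ _ (k *: q - v) _ e0_gt0) => e e_gt0 /(H e e_gt0)[Tv Hv].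
have -> : - z + e *: (k *: q - v) = (e * k) *: q - (z + e *: v) by vring.
exact: (Mratio_closure Tc (comparable_pair_cone Tc T0 Tv Tq) Hv).
Qed.

(* The step from [A] to its tangent cone at [z]: test the inequality at
   [z + e v] and let [e] tend to 0. *)
Lemma tcone_Mratio_le A S T z p q (k : R) :
  open_cone A -> open_cone S -> open_cone T -> ~ S 0 -> ~ T 0 -> S p -> T q ->
  closure A z -> A `<=` T -> A `<=` S -> closure S (- z) ->
  (forall u, A u -> Mratio T u q <= k * Mratio S u p) ->
  tcone A z `<=` T /\ forall v, tcone A z v -> Mratio T v q <= k * Mratio S v p.
Proof.
move=> Ac Sc Tc S0 T0 Sp Tq Az AT AS Sz H.
have k_ge0 : 0 <= k.
  have [[a Aa] _ _ _] := Ac.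
  have m1 := Mratio_gt0 Tc (comparable_pair_cone Tc T0 (AT _ Aa) Tq).
  have m2 := Mratio_gt0 Sc (comparable_pair_cone Sc S0 (AS _ Aa) Sp).
  by rewrite -(pmulr_lge0 _ m2); apply: le_trans (ltW m1) (H _ Aa).
have near v : tcone A z v -> exists2 e0 : R, 0 < e0 & forall e : R, 0 < e -> e <= e0 ->
    A (z + e *: v) /\ Mratio T (z + e *: v) q <= e * (k * Mratio S v p).
  move=> zv; have [e0 e0_gt0 He0] := tcone_near Ac zv Az.
  exists e0 => // e e_gt0 e_le; have Ae := He0 e e_gt0 e_le; split; first exact: Ae.
  apply: (le_trans (H _ Ae)); rewrite mulrCA; apply: ler_wpM2l => //.
  have Sv := tcone_sub Ac Sc Az AS Sz zv.
  exact: (Mratio_shift_le Sc S0 Sp Sv Sz e_gt0 (AS _ Ae)).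
have Tz : closure T (- z).
  have [[v zv] _ _ _] := open_cone_tcone Ac Az.
  have [e0 e0_gt0 He0] := near v zv.
  apply: (Mratio_shift_lineality (v := v) (k := k * Mratio S v p) Tc T0 Tq e0_gt0).
  by move=> e e_gt0 /ltW/(He0 e e_gt0)[/AT ? ?]; split.
have zT := tcone_sub Ac Tc Az AT Tz; split=> // v zv.
(* The factor [e] cancels on both sides, so the single value [e0] suffices here. *)
have [e0 e0_gt0 /(_ e0 e0_gt0 (lexx _))[Ae le_e]] := near v zv.
rewrite -(ler_pM2l e0_gt0); apply: le_trans le_e.
exact: (Mratio_shift_ge Tc T0 Tq (zT _ zv) (closureS AT Az) e0_gt0 (AT _ Ae)).
Qed.

(** Only the domain of the inequality grows, from [A] to [S']. Every intermediate cone lies in [S],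
    so each point [z] of the chain satisfies [closure S (- z)], as the single step requires. *)
Lemma iterGamma_Mratio_le (j : nat) A S' S T p q (k : R) :
  open_cone A -> ~ A 0 -> open_cone S -> open_cone T -> ~ S 0 -> ~ T 0 -> S p -> T q ->
  A `<=` T -> (forall u, A u -> Mratio T u q <= k * Mratio S u p) ->
  iterGamma j A S' -> S' `<=` S ->
  S' `<=` T /\ forall u, S' u -> Mratio T u q <= k * Mratio S u p.
Proof.
move=> Ac A0 Sc Tc S0 T0 Sp Tq AT H.
rewrite /iterGamma; elim: j S' => [S' -> _ //|j IH S'] /=.
move=> [U [z [HU [Uz _] ->]]] zS; have [Uc _ _] := iterGammaP Ac A0 HU.
have US := subset_trans (subset_tcone Uc Uz) zS.
have [UT HUT] := IH _ HU US.
apply: (tcone_Mratio_le Uc Sc Tc S0 T0 Sp Tq Uz UT US _ HUT).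
exact: (closureS zS (closure_tconeN Uc Uz)).
Qed.

Lemma comparable_pair_bdry C x w : open_cone C -> proper_cone C -> closure C x -> x != 0 ->
  C w -> comparable_pair C x w.
Proof.
move=> Cc Cp Cx x0 Cw; split; [exact: subset_closure|exact: proper_closureN|].
exact: cone_dominates.
Qed.

Lemma inv_onemV_le2 (e e0 : R) : 0 < e0 -> e < e0 / 2 -> (1 - e / e0)^-1 <= 2.
Proof.
move=> e0_gt0 e_lt.
have t_ge : 2^-1 <= 1 - e / e0.
  have : e / e0 <= 2^-1 by rewrite ler_pdivrMr //; lra.
  by lra.
by rewrite invf_ple ?posrE //; apply: lt_le_trans t_ge.
Qed.

(* On [w = x + e u] with [e] tending to 0, M(x/w) tends to 1, M(y/w) stays away
   from 0 and M(w/p; S) is of order [e]: hence M(w/q; T) is also of order [e],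
   and then M(y/w) stays bounded. *)
Lemma first_tcone_Mratio_le C S T x y p q (k : R) :
  open_cone C -> proper_cone C -> open_cone S -> open_cone T -> ~ S 0 -> ~ T 0 ->
  S p -> T q -> bdry C x -> x != 0 -> bdry C y -> y != 0 ->
  C `<=` T -> C `<=` S -> closure S (- x) ->
  (forall w, C w ->
     Mratio C y w * Mratio T w q <= k * (Mratio C x w * Mratio S w p)) ->
  [/\ comparable_pair C y x, tcone C x `<=` T &
      forall u, tcone C x u -> Mratio C y x * Mratio T u q <= k * Mratio S u p].
Proof.
move=> Cc Cp Sc Tc S0 T0 Sp Tq [Cx nCx] x0 [Cy _] y0 CT CS Sx H.
have cx w : C w -> comparable_pair C x w by exact: comparable_pair_bdry.
have cy w : C w -> comparable_pair C y w by exact: comparable_pair_bdry.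
have cT w : T w -> comparable_pair T w q by move=> Tw; exact: comparable_pair_cone.
have cS w : S w -> comparable_pair S w p by move=> Sw; exact: comparable_pair_cone.
have k_ge0 : 0 <= k.
  have [[a Ca] _ _ _] := Cc.
  have m1 := Mratio_gt0 Tc (cT _ (CT _ Ca)); have m2 := Mratio_gt0 Cc (cy _ Ca).
  have m3 := Mratio_gt0 Sc (cS _ (CS _ Ca)); have m4 := Mratio_gt0 Cc (cx _ Ca).
  rewrite -(pmulr_lge0 _ (mulr_gt0 m4 m3)); exact: le_trans (ltW (mulr_gt0 m2 m1)) (H _ Ca).
have near u : tcone C x u -> exists2 e0 : R, 0 < e0 & forall e : R, 0 < e -> e < e0 ->
    C (x + e *: u) /\ Mratio C y (x + e *: u) * Mratio T (x + e *: u) q <=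
      e * (k * (1 - e / e0)^-1 * Mratio S u p).
  move=> xu; have [e0 e0_gt0 He0] := tcone_near Cc xu Cx.
  exists e0 => // e e_gt0 e_lt; have Ce := He0 e e_gt0 (ltW e_lt); split; first exact: Ce.
  have Su := tcone_sub Cc Sc Cx CS Sx xu.
  have t_gt0 : 0 < 1 - e / e0 by rewrite subr_gt0 ltr_pdivrMr // mul1r.
  apply: (le_trans (H _ Ce)).
  rewrite [leRHS](_ : _ = k * ((1 - e / e0)^-1 * (e * Mratio S u p))); last first.
    by move: (Mratio S u p) (1 - e / e0)^-1 => m1 m2; ring.
  apply: ler_wpM2l => //; apply: ler_pM.
  - exact/ltW/(Mratio_gt0 Cc (cx _ Ce)).
  - exact/ltW/(Mratio_gt0 Sc (cS _ (CS _ Ce))).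
  - apply: (Mratio_le Cc (cx _ Ce)).
    (* The point [x + e *: u] is the convex combination of [x] and [x + e0 *: u] with weights
       [1 - e / e0] and [e / e0]; hence M(x/w) is at most [(1 - e / e0)^-1]. *)
    have -> : (1 - e / e0)^-1 *: (x + e *: u) - x =
        ((1 - e / e0)^-1 * (e / e0)) *: (x + e0 *: u).
      have t_neq0 : e0 - e != 0 by rewrite subr_eq0 gt_eqF.
      by vfield; rewrite t_neq0 gt_eqF.
    apply: (closure_coneZ Cc); last exact: (subset_closure (He0 _ e0_gt0 (lexx _))).
    by rewrite mulr_ge0 ?invr_ge0 ?divr_ge0 // ltW.
  - exact: (Mratio_shift_le Sc S0 Sp Su Sx e_gt0 (CS _ Ce)).
have Tx : closure T (- x).
  have [[u xu] _ _ _] := open_cone_tcone Cc Cx.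
  have [e0 e0_gt0 He0] := near u xu.
  have Su := tcone_sub Cc Sc Cx CS Sx xu.
  have h_gt0 : 0 < e0 / 2 by rewrite divr_gt0.
  have h_lt : e0 / 2 < e0 by lra.
  have [Cw0 _] := He0 _ h_gt0 h_lt.
  (* For [e < e0 / 2] the difference [w1 - (x + e *: u)] lies in [C], so M(y/w1) is a lower bound,
     uniform in [e], for M(y/w) at [w = x + e *: u]. *)
  pose w1 := x + (x + (e0 / 2) *: u).
  have Cw1 : C w1 by rewrite /w1 addrC; exact: coneDcl.
  pose c := Mratio C y w1; have c_gt0 : 0 < c by exact: (Mratio_gt0 Cc (cy _ Cw1)).
  apply: (Mratio_shift_lineality (v := u) (k := k * 2 * Mratio S u p / c) Tc T0 Tq h_gt0).
  move=> e e_gt0 e_lt; have [Ce He] := He0 e e_gt0 (lt_trans e_lt h_lt).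
  split; first exact: (CT _ Ce).
  have t_le := inv_onemV_le2 e0_gt0 e_lt.
  have c_le : c <= Mratio C y (x + e *: u).
    apply: (Mratio_le Cc (cy _ Cw1)).
    have := Mratio_closure Cc (cy _ Ce) (lexx _).
    have := ltW (Mratio_gt0 Cc (cy _ Ce)).
    move: (Mratio C y (x + e *: u)) => m m_ge0 Cm.
    have -> : m *: w1 - y =
        (m *: (x + e *: u) - y) + m *: (x + (e0 / 2 - e) *: u) by rewrite /w1; vring.
    have d_gt0 : 0 < e0 / 2 - e by rewrite subr_gt0.
    have d_lt : e0 / 2 - e < e0 by rewrite ltrBlDr (lt_trans h_lt) // ltrDl.
    have [Ch _] := He0 _ d_gt0 d_lt.
    exact: (closure_coneD Cc Cm (closure_coneZ Cc m_ge0 (subset_closure Ch))).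
  rewrite mulrA (ler_pdivlMr _ _ c_gt0) mulrC.
  have mT := Mratio_gt0 Tc (cT _ (CT _ Ce)).
  have mS := Mratio_gt0 Sc (cS _ Su).
  apply: (le_trans (ler_wpM2r (ltW mT) c_le)); apply: (le_trans He).
  apply: ler_wpM2l; first exact: ltW.
  by apply: ler_wpM2r; [exact: ltW|exact: ler_wpM2l].
have xT := tcone_sub Cc Tc Cx CT Tx.
have key u : tcone C x u -> closure C ((k * Mratio S u p / Mratio T u q) *: x - y).
  move=> xu; have [e0 e0_gt0 He0] := near u xu.
  set B := k * Mratio S u p / Mratio T u q.
  have mT := Mratio_gt0 Tc (cT _ (xT _ xu)).
  (* Multiplying [(B / (1 - e / e0)) *: (x + e *: u) - y] by [1 - e / e0] leaves [B *: x - y] plus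
     [e] times this direction. *)
  apply: (@closure_line _ _ _ _ (B *: u + e0^-1 *: y) _ e0_gt0) => e e_gt0 e_lt.
  have [Ce He] := He0 e e_gt0 e_lt.
  have t_gt0 : 0 < 1 - e / e0 by rewrite subr_gt0 ltr_pdivrMr // mul1r.
  have : Mratio C y (x + e *: u) <= B / (1 - e / e0).
    rewrite -(ler_pM2r mT) -(ler_pM2l e_gt0).
    rewrite [leRHS](_ : _ = e * (k * (1 - e / e0)^-1 * Mratio S u p)); last first.
      rewrite /B; move: (Mratio T u q) mT (Mratio S u p) ((1 - e / e0)^-1) => m1 m1_gt0 m2 t.
      by field; rewrite gt_eqF.
    apply: le_trans He; rewrite mulrCA; apply: ler_wpM2l.
      exact/ltW/(Mratio_gt0 Cc (cy _ Ce)).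
    exact: (Mratio_shift_ge Tc T0 Tq (xT _ xu) (closureS CT Cx) e_gt0 (CT _ Ce)).
  move=> /(Mratio_closure Cc (cy _ Ce)).
  move: B => B /(closure_coneZ Cc (ltW t_gt0)); congr (closure C).
  have t_neq0 : e0 - e != 0 by rewrite subr_eq0 gt_eqF.
  by vfield; rewrite t_neq0 gt_eqF.
have cyx : comparable_pair C y x.
  split; [exact: Cx|exact: proper_closureN|].
  by have [[u /key Hu] _ _ _] := open_cone_tcone Cc Cx; eexists; exact: Hu.
split; [exact: cyx|exact: xT|move=> u xu].
have mT := Mratio_gt0 Tc (cT _ (xT _ xu)).
rewrite -(ler_pdivlMr _ _ mT); exact: (Mratio_le Cc cyx (key _ xu)).
Qed.

Lemma Tset_tconeP C x S : open_cone C -> bdry C x -> Tset (tcone C x) S ->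
  [/\ open_cone S, ~ S 0, C `<=` S & closure S (- x)].
Proof.
move=> Cc Cx [j [_ HS]]; have [Cx' _] := Cx.
have [Sc S0 xS] := iterGammaP (open_cone_tcone Cc Cx') (tcone_not0 Cc Cx) HS.
split=> //; first exact: (subset_trans (subset_tcone Cc Cx') xS).
exact: (closureS xS (closure_tconeN Cc Cx')).
Qed.

Lemma Mratio_product_bound C S T x y p q (k : R) :
  open_cone C -> proper_cone C -> bdry C x -> x != 0 -> bdry C y -> y != 0 ->
  Tset (tcone C x) S -> Tset (tcone C y) T -> S p -> T q ->
  (forall w, C w ->
     Mratio C y w * Mratio T w q <= k * (Mratio C x w * Mratio S w p)) ->
  [/\ comparable_pair C y x, S `<=` T &
      forall u, S u -> Mratio C y x * Mratio T u q <= k * Mratio S u p].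
Proof.
move=> Cc Cp Cx x0 Cy y0 HS HT Sp Tq H.
have [Sc S0 CS Sx] := Tset_tconeP Cc Cx HS.
have [Tc T0 CT _] := Tset_tconeP Cc Cy HT.
have [cyx xT Hx] := first_tcone_Mratio_le Cc Cp Sc Tc S0 T0 Sp Tq Cx x0 Cy y0 CT CS Sx H.
have m_gt0 := Mratio_gt0 Cc cyx; have [Cx' _] := Cx.
have Hx' u : tcone C x u -> Mratio T u q <= (Mratio C y x)^-1 * k * Mratio S u p.
  by move=> /Hx; rewrite -mulrA (ler_pdivlMl _ _ m_gt0).
case: HS => j [_ HS].
have [ST HST] := iterGamma_Mratio_le (open_cone_tcone Cc Cx') (tcone_not0 Cc Cx)
  Sc Tc S0 T0 Sp Tq xT Hx' HS (subset_refl (A := S)).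
split; [exact: cyx|exact: ST|move=> u /HST].
by rewrite -mulrA (ler_pdivlMl _ _ m_gt0).
Qed.

(** Prolonging the segment from [u] slightly beyond [x] within the closure amounts to domination of
    [u] by a multiple of [x]. *)
Lemma faceP C x u : open_cone C -> closure C x ->
  face C x u <-> closure C u /\ exists l : R, closure C (l *: x - u).
Proof.
move=> Cc Cx; split=> [[Cu [->|[e [e_gt0 He]]]]|[Cu [l Cl]]].
- by split=> //; exists 1; rewrite scale1r subrr; exact: closure_cone0.
- split=> //; pose s := e / 2; have s_gt0 : 0 < s by rewrite divr_gt0.
  exists ((1 + s) / s).
  have -> : ((1 + s) / s) *: x - u = s^-1 *: (x + (- s) *: (u - x)).
    by vfield; rewrite gt_eqF.
  apply: (closure_coneZ Cc); first by rewrite invr_ge0 ltW.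
  by apply: He; rewrite normrN gtr0_norm // /s; lra.
(* For [s >= 0] the bound [m >= 1] gives a convex combination; for [s < 0] the bound [l <= m] keeps
   the coefficient [1 - s + s * l] of [x] nonnegative. *)
- split=> //; right; pose m := 1 + `|l|.
  have m_gt0 : 0 < m by rewrite ltr_pwDl.
  exists m^-1; rewrite invr_gt0; split=> [//|s s_lt].
  have sm : `|s| * m <= 1 by rewrite -ler_pdivlMr // div1r ltW.
  have m_ge1 : 1 <= m by rewrite /m lerDl.
  have s_le1 : `|s| <= 1 by apply: le_trans sm; rewrite ler_peMr.
  have [s_ge0|s_lt0] := leP 0 s.
    have -> : x + s *: (u - x) = (1 - s) *: x + s *: u by vring.
    rewrite (ger0_norm s_ge0) in s_le1.
    by apply: (closure_coneD Cc); apply: (closure_coneZ Cc) => //; rewrite subr_ge0.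
  rewrite (ltr0_norm s_lt0) in sm.
  have -> : x + s *: (u - x) = (1 - s + s * l) *: x + (- s) *: (l *: x - u) by vring.
  apply: (closure_coneD Cc); apply: (closure_coneZ Cc) => //; last by rewrite oppr_ge0 ltW.
  have : - s * l <= - s * m.
    apply: ler_wpM2l; first by rewrite oppr_ge0 ltW.
    by rewrite /m; have := ler_norm l; lra.
  by rewrite mulNr; lra.
Qed.

Lemma face_eqP C x y : open_cone C -> closure C x -> closure C y ->
  face C x = face C y <->
  (exists l : R, closure C (l *: x - y)) /\ (exists l : R, closure C (l *: y - x)).
Proof.
move=> Cc Cx Cy.
have refl z : closure C z -> face C z z.
  move=> Cz; apply/faceP => //; split=> //; exists 1; rewrite scale1r subrr.
  exact: closure_cone0.
have trans z z' : closure C z -> closure C z' ->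
    (exists l : R, closure C (l *: z - z')) -> face C z' `<=` face C z.
  move=> Cz Cz' [l Cl] u /(faceP _ Cc Cz')[Cu [m Cm]]; apply/faceP => //; split=> //.
  exists (`|m| * l).
  have -> : (`|m| * l) *: z - u = `|m| *: (l *: z - z') +
    ((m *: z' - u) + (`|m| - m) *: z') by vring.
  apply: (closure_coneD Cc); first exact: (closure_coneZ Cc).
  apply: (closure_coneD Cc Cm); apply: (closure_coneZ Cc) => //.
  by rewrite subr_ge0 ler_norm.
split=> [E|[xy yx]].
  have /(faceP _ Cc Cx)[_ Hx] : face C x y by rewrite E; exact: refl.
  have /(faceP _ Cc Cy)[_ Hy] : face C y x by rewrite -E; exact: refl.
  by split.
by apply/seteqP; split; apply: trans.
Qed.

(** A vector [l *: z' - z] in the closure of [C] differs from [l *: z'] by [z], also in that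
    closure; it is thus dominated by [z'] and lies in the face already. *)
Lemma Mratio_face C x z z' : open_cone C -> closure C x -> closure C z ->
  face C x z' -> face C x = face C z' -> Mratio (face C x) z z' = Mratio C z z'.
Proof.
move=> Cc Cx Cz xz' E; apply: eq_Mratio => l l_gt0; split=> Hl.
  have FC : face C x `<=` closure C by move=> u [].
  by rewrite (proj1 (closure_id _) (@closed_closure _ C)); apply: (closureS FC).
have [Cz' _] := xz'; apply: subset_closure; rewrite E.
apply/(faceP _ Cc Cz'); split; first exact: Hl.
by exists l; rewrite opprB addrC subrK.
Qed.

End TangentChains.

(** * Busemann points and bounds on the detour cost *)

Section Horofunctions.
Set Implicit Arguments.
Unset Strict Implicit.
Variables (R : realType) (n : nat).
Local Notation V := 'rV[R]_(n.+1).
Local Opaque Mratio.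
Implicit Types (A C K S T : set V) (b u v w x y z p q : V).

Lemma hilbert_refl C w : open_cone C -> ~ C 0 -> C w -> hilbert C w w = 0.
Proof.
by move=> Cc C0 Cw; rewrite /hilbert /funk /rfunk (Mratio_refl Cc C0 Cw) ln1 addr0.
Qed.

Lemma ln_Mratio_triangle K a c d : open_cone K ->
  comparable_pair K a c -> comparable_pair K c d ->
  ln (Mratio K a d) <= ln (Mratio K a c) + ln (Mratio K c d).
Proof.
move=> Kc Kac Kcd; have Kad := comparable_pair_trans Kc Kac Kcd.
have m1 := Mratio_gt0 Kc Kac; have m2 := Mratio_gt0 Kc Kcd.
rewrite -lnM ?posrE; [|exact: m1|exact: m2].
rewrite ler_ln ?posrE; [|exact: (Mratio_gt0 Kc Kad)|exact: (mulr_gt0 m1 m2)].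
exact: Mratio_triangle.
Qed.

(** The triangle inequality bounds the reverse-Funk part by the ratio of [w] over [v] in [C], and
    the Funk part by that of [v] over [w] in [S], which is at most the one in [C]. *)
Lemma horofunction_lipschitz C b x S p v w : open_cone C -> proper_cone C -> ~ C 0 ->
  closure C x -> x != 0 -> open_cone S -> ~ S 0 -> C `<=` S -> S p -> C v -> C w ->
  (rbus C b x v + fbus S b p v) - (rbus C b x w + fbus S b p w) <= hilbert C v w.
Proof.
move=> Cc Cp C0 Cx x0 Sc S0 CS Sp Cv Cw.
rewrite /rbus /fbus /hilbert /funk /rfunk.
have h1 := ln_Mratio_triangle Cc (comparable_pair_bdry Cc Cp Cx x0 Cw)
  (comparable_pair_cone Cc C0 Cw Cv).
have h2 := ln_Mratio_triangle Sc (comparable_pair_cone Sc S0 (CS _ Cv) (CS _ Cw))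
  (comparable_pair_cone Sc S0 (CS _ Cw) Sp).
have Cvw := comparable_pair_cone Cc C0 Cv Cw.
have Svw := comparable_pair_cone Sc S0 (CS _ Cv) (CS _ Cw).
have h3 : ln (Mratio S v w) <= ln (Mratio C v w).
  rewrite ler_ln ?posrE; [|exact: Mratio_gt0|exact: Mratio_gt0].
  exact: MratioS.
have real_ineq (a1 a2 a3 a4 a5 a6 a7 a8 a9 : R) : a1 <= a2 + a3 -> a4 <= a5 + a6 ->
    a5 <= a7 -> a1 - a8 + (a4 - a9) - (a2 - a8 + (a6 - a9)) <= a7 + a3 by clear; lra.
exact: (real_ineq _ _ _ _ _ _ _ _ _ h1 h2 h3).
Qed.

Lemma conv_horo_pt C b (T0 : set R) (gam : R -> V) (xi : V -> R) w (e : R) : conv_horo C b T0 gam xi -> C w -> 0 < e ->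
  exists M : R, forall t, T0 t -> M <= t -> `|horo C b (gam t) w - xi w| < e.
Proof.
move=> cv Cw e_gt0.
have wC : [set w] `<=` C by move=> ? ->.
have [M HM] := cv _ (@compact_set1 _ w) wC _ e_gt0.
by exists M => t T0t Mt; apply: HM.
Qed.

(** Along any path, [hilbert C w (gam t) - hilbert C b (gam t)] tends to [xi w], while [eta (gam t)]
    is at least [eta w - hilbert C w (gam t)]. *)
Lemma detour_ge C b (xi eta : V -> R) w : C w ->
  (forall v, C v -> eta w - eta v <= hilbert C w v) ->
  ((eta w - xi w)%:E <= detour C b xi eta)%E.
Proof.
move=> Cw Hlip; apply: le_ereal_inf_tmp => _ [T0 [gam [[_ Cg] cv ->]]].
apply/lee_addgt0Pr => e e_gt0.
have [M HM] := conv_horo_pt cv Cw e_gt0.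
suff : ((eta w - xi w - e)%:E <= path_liminf T0 (fun t => hilbert C b (gam t) + eta (gam t))%R)%E.
  by rewrite EFinB leeBlDr.
apply: ereal_sup_ge; eexists; first by exists M.
apply: le_ereal_inf_tmp => _ [t [T0t Mt] <-]; rewrite lee_fin.
have real_ineq (a1 a2 a3 a4 a5 : R) : a1 - a2 <= a3 -> `|a3 - a4 - a5| < e ->
    a1 - a5 - e <= a4 + a2 by rewrite ltr_norml; clear => ? /andP[_ ?]; lra.
exact: (real_ineq _ _ _ _ _ (Hlip _ (Cg t T0t)) (HM t T0t Mt)).
Qed.

(** Convergence at [gam 0] and [gam s] expresses both terms by distances along the path, and
    almost-geodesicity makes these cancel. Five approximations occur, hence [e / 5]. *)
Lemma almost_geodesic_horo C b (T0 : set R) (gam : R -> V) (xi : V -> R) (e : R) : open_cone C -> ~ C 0 -> C b ->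
  almost_geodesic C T0 gam -> conv_horo C b T0 gam xi -> 0 < e ->
  exists M : R, forall s, T0 s -> M <= s -> hilbert C b (gam s) + xi (gam s) <= e.
Proof.
move=> Cc C0 Cb [[unb Cg] T00 ag] cv e_gt0.
have e5 : 0 < e / 5 by rewrite divr_gt0.
have [M1 HM1] := ag _ e5.
have Cg0 := Cg 0 T00.
have [M2 HM2] := conv_horo_pt cv Cg0 e5.
exists (Num.max M1 M2) => s T0s; rewrite ge_max => /andP[M1s M2s].
(* This threshold depends on [s], so [t] is chosen after [s]. *)
have [M3 HM3] := conv_horo_pt cv (Cg s T0s) e5.
have [t [T0t]] := unb (Num.max s (Num.max M2 M3)).
rewrite !ge_max => /andP[st /andP[M2t M3t]].
have h1 := HM1 s t T0s T0t M1s st.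
(* Equal times turn the condition into an estimate of [hilbert C (gam 0) (gam t)] by [t]. *)
have h2 := HM1 t t T0t T0t (le_trans M1s st) (lexx t).
rewrite (hilbert_refl Cc C0 (Cg t T0t)) addr0 in h2.
have h3 := HM3 t T0t M3t; have h4 := HM2 t T0t M2t; have h5 := HM2 s T0s M2s.
have real_ineq (a1 a2 a3 a4 a5 a6 a7 : R) : `|a1 + a2 - t| < e / 5 ->
    `|a3 - t| < e / 5 -> `|a2 - a4 - a6| < e / 5 -> `|a3 - a4 - a7| < e / 5 ->
    `|a1 - a5 - a7| < e / 5 -> a5 + a6 <= e.
  rewrite !ltr_norml; clear.
  by move=> /andP[? ?] /andP[? ?] /andP[? ?] /andP[? ?] /andP[? ?]; lra.
exact: (real_ineq _ _ _ _ _ _ _ h1 h2 h3 h4 h5).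
Qed.

(** Take the almost-geodesic of [xi] as path: the cost is [eta - xi] plus
    [hilbert C b (gam t) + xi (gam t)], and the latter is eventually below any [e > 0]. *)
Lemma detour_le C b (xi eta : V -> R) (B : R) : open_cone C -> ~ C 0 -> C b ->
  busemann C b xi -> (forall w, C w -> eta w - xi w <= B) ->
  (detour C b xi eta <= B%:E)%E.
Proof.
move=> Cc C0 Cb [[T0 [gam [ag cv]]] _] HB.
have [[unb Cg] _ _] := ag.
apply: ge_ereal_inf; eexists; first by exists T0, gam; split; [split|exact: cv|].
apply: ge_ereal_sup => _ [M _ <-].
apply/lee_addgt0Pr => e e_gt0.
have [M' HM'] := almost_geodesic_horo Cc C0 Cb ag cv e_gt0.
have [t [T0t]] := unb (Num.max M M'); rewrite ge_max => /andP[Mt M't].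
apply: ge_ereal_inf; eexists; first by exists t.
rewrite -EFinD lee_fin.
have real_ineq (a1 a2 a3 : R) : a1 - a3 <= B -> a2 + a3 <= e -> a2 + a1 <= B + e.
  by clear; lra.
exact: (real_ineq _ _ _ (HB _ (Cg t T0t)) (HM' t T0t M't)).
Qed.

End Horofunctions.

(** * The detour cost between boundary horofunctions *)

Section DetourCost.
Set Implicit Arguments.
Unset Strict Implicit.
Variables (R : realType) (n : nat).
Local Notation V := 'rV[R]_(n.+1).
Local Opaque Mratio.
Implicit Types (A C K S T : set V) (b u v w x y z p q : V).

Definition boundary_horofunction C b S x p w : R := rbus C b x w + fbus S b p w.

Definition horofunction_datum C S x p :=
  [/\ bdry C x, x != 0, Tset (tcone C x) S & S p].

(** The normalisation at [b] of the difference of two horofunctions. It changes sign when they are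
    exchanged, so it drops out of the detour metric. *)
Definition base_shift C b S T x y p q : R :=
  ln (Mratio C y b) + ln (Mratio T b q) - (ln (Mratio C x b) + ln (Mratio S b p)).

Lemma boundary_horofunctionB C b S T x y p q w :
  boundary_horofunction C b T y q w - boundary_horofunction C b S x p w =
  ln (Mratio C y w) + ln (Mratio T w q) - (ln (Mratio C x w) + ln (Mratio S w p)) -
  base_shift C b S T x y p q.
Proof.
rewrite /boundary_horofunction /rbus /fbus /rfunk /funk /base_shift.
have real_eq (a1 a2 a3 a4 a5 a6 a7 a8 : R) :
  a1 - a2 + (a3 - a4) - (a5 - a6 + (a7 - a8)) =
  a1 + a3 - (a5 + a7) - (a2 + a4 - (a6 + a8)) by ring.
exact: real_eq.
Qed.

(** Exponentiating the bound gives the product inequality of [Mratio_product_bound], with the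
    normalisation absorbed into the constant. *)
Lemma boundary_horofunction_bounded C b S T x y p q (B : R) :
  open_cone C -> proper_cone C ->
  horofunction_datum C S x p -> horofunction_datum C T y q ->
  (forall w, C w ->
     boundary_horofunction C b T y q w - boundary_horofunction C b S x p w <= B) ->
  [/\ comparable_pair C y x, S `<=` T &
      forall u, S u -> Mratio C y x * Mratio T u q <=
        expR (B + base_shift C b S T x y p q) * Mratio S u p].
Proof.
move=> Cc Cp [Cx x0 HS Sp] [Cy y0 HT Tq] HB.
apply: (Mratio_product_bound Cc Cp Cx x0 Cy y0 HS HT Sp Tq) => w Cw.
have [Sc S0 CS _] := Tset_tconeP Cc Cx HS.
have [Tc T0 CT _] := Tset_tconeP Cc Cy HT.
have [Cx' _] := Cx; have [Cy' _] := Cy.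
have m1 := Mratio_gt0 Cc (comparable_pair_bdry Cc Cp Cy' y0 Cw).
have m2 := Mratio_gt0 Tc (comparable_pair_cone Tc T0 (CT _ Cw) Tq).
have m3 := Mratio_gt0 Cc (comparable_pair_bdry Cc Cp Cx' x0 Cw).
have m4 := Mratio_gt0 Sc (comparable_pair_cone Sc S0 (CS _ Cw) Sp).
have := HB w Cw; rewrite boundary_horofunctionB.
have real_ineq (a1 a2 a3 a4 c : R) : 0 < a1 -> 0 < a2 -> 0 < a3 -> 0 < a4 ->
    ln a1 + ln a2 - (ln a3 + ln a4) - c <= B -> a1 * a2 <= expR (B + c) * (a3 * a4).
  move=> a1_gt0 a2_gt0 a3_gt0 a4_gt0 h.
  rewrite -ler_ln ?posrE ?mulr_gt0 ?expR_gt0 // !lnM ?posrE ?mulr_gt0 ?expR_gt0 //.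
  by rewrite expRK; move: h; clear; lra.
exact: (real_ineq _ _ _ _ _ m1 m2 m3 m4).
Qed.

Lemma boundary_horofunction_lipschitz C b S x p v w : open_cone C -> proper_cone C ->
  horofunction_datum C S x p -> C v -> C w ->
  boundary_horofunction C b S x p v - boundary_horofunction C b S x p w <= hilbert C v w.
Proof.
move=> Cc Cp [Cx x0 HS Sp] Cv Cw.
have [Sc S0 CS _] := Tset_tconeP Cc Cx HS; have [Cx' _] := Cx.
have C0 := bdry_not0 Cc Cx.
exact: horofunction_lipschitz.
Qed.

(** By [detour_ge] the cost dominates [h - g] on [C]. This difference vanishes at [b], and a finite
    cost is itself a bound to which [boundary_horofunction_bounded] applies. *)
Lemma detour_ltoo C b S T x y p q :
  open_cone C -> proper_cone C -> C b ->
  horofunction_datum C S x p -> horofunction_datum C T y q ->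
  let g := boundary_horofunction C b S x p in
  let h := boundary_horofunction C b T y q in
  (0 <= detour C b g h)%E /\
  (detour C b g h != +oo%E -> comparable_pair C y x /\ S `<=` T).
Proof.
move=> Cc Cp Cb dx dy g h.
have lb w : C w -> ((h w - g w)%:E <= detour C b g h)%E.
  move=> Cw; apply: detour_ge => // v Cv; exact: boundary_horofunction_lipschitz.
have ge0 : (0 <= detour C b g h)%E.
  have := lb b Cb; rewrite /g /h boundary_horofunctionB.
  by rewrite /base_shift subrr.
split=> //; move: lb ge0; case: (detour C b g h) => [B lb _ _|//|_ //].
by have [] := boundary_horofunction_bounded (b := b) (B := B) Cc Cp dx dy lb.
Qed.

(* Both bounds on sup (h - g): the lower one by [boundary_horofunction_bounded] at
   [u = p], the upper one by the triangle inequalities of the Funk and reverse-Funk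
   metrics. *)
Lemma detour_boundary_horofunction C b S x y p q :
  open_cone C -> proper_cone C -> C b ->
  horofunction_datum C S x p -> horofunction_datum C S y q -> comparable_pair C y x ->
  busemann C b (boundary_horofunction C b S x p) ->
  detour C b (boundary_horofunction C b S x p) (boundary_horofunction C b S y q) =
  (ln (Mratio C y x) + ln (Mratio S p q) - base_shift C b S S x y p q)%:E.
Proof.
move=> Cc Cp Cb dx dy cyx bus.
have [Cx x0 HS Sp] := dx; have [Cy y0 _ Sq] := dy.
have [Sc S0 CS _] := Tset_tconeP Cc Cx HS; have [Cx' _] := Cx.
have C0 := bdry_not0 Cc Cx.
have spq := comparable_pair_cone Sc S0 Sp Sq.
apply/eqP; rewrite eq_le; apply/andP; split.
  apply: (detour_le Cc C0 Cb bus) => w Cw; rewrite boundary_horofunctionB.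
  have h1 := ln_Mratio_triangle Cc cyx (comparable_pair_bdry Cc Cp Cx' x0 Cw).
  have h2 := ln_Mratio_triangle Sc (comparable_pair_cone Sc S0 (CS _ Cw) Sp) spq.
  have real_ineq (a1 a2 a3 a4 a5 a6 c : R) : a1 <= a2 + a3 -> a4 <= a5 + a6 ->
    a1 + a4 - (a3 + a5) - c <= a2 + a6 - c by clear; lra.
  exact: (real_ineq _ _ _ _ _ _ _ h1 h2).
have lb w : C w -> ((boundary_horofunction C b S y q w -
    boundary_horofunction C b S x p w)%:E <=
    detour C b (boundary_horofunction C b S x p) (boundary_horofunction C b S y q))%E.
  by move=> Cw; apply: detour_ge => // v Cv; exact: boundary_horofunction_lipschitz.
move: lb; case: (detour _ _ _ _) => [B lb|_|/(_ b Cb)//]; last exact: leey.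
rewrite lee_fin.
have [_ _ /(_ p Sp)] := boundary_horofunction_bounded (b := b) (B := B) Cc Cp dx dy lb.
rewrite (Mratio_refl Sc S0 Sp) mulr1.
have m1 := Mratio_gt0 Cc cyx; have m2 := Mratio_gt0 Sc spq.
have real_ineq (a1 a2 c : R) : 0 < a1 -> 0 < a2 ->
    a1 * a2 <= expR (B + c) -> ln a1 + ln a2 - c <= B.
  move=> a1_gt0 a2_gt0; rewrite -ler_ln ?posrE ?mulr_gt0 ?expR_gt0 //.
  by rewrite lnM ?posrE // expRK; clear; lra.
exact: real_ineq.
Qed.

End DetourCost.

Theorem theorem4p7 (R : realType) (n : nat) (C : set (pt R n))
  (b x y p q : pt R n) (S T : set (pt R n)) :
  open_cone C -> proper_cone C -> C b ->
  bdry C x -> x != 0 -> bdry C y -> y != 0 ->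
  Tset (tcone C x) S -> Tset (tcone C y) T -> S p -> T q ->
  busemann C b (fun w => rbus C b x w + fbus S b p w) ->
  busemann C b (fun w => rbus C b y w + fbus T b q w) ->
  let g := fun w => rbus C b x w + fbus S b p w in
  let h := fun w => rbus C b y w + fbus T b q w in
  (face C x = face C y /\ S = T ->
     detour_metric C b g h = (hilbert (face C x) x y + hilbert S p q)%:E) /\
  (~ (face C x = face C y /\ S = T) -> detour_metric C b g h = +oo%E).
Proof.
move=> Cc Cp Cb Cx x0 Cy y0 HS HT Sp Tq gbus hbus g h.
have dx : horofunction_datum C S x p by split.
have dy : horofunction_datum C T y q by split.
have [Cx' _] := Cx; have [Cy' _] := Cy.
have facexy := face_eqP Cc Cx' Cy'.
rewrite /detour_metric; split.
  move=> [Fxy ST]; subst T.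
  have [xy yx] := proj1 facexy Fxy.
  have cyx : comparable_pair C y x.
    by split; [exact: Cx'|exact: (proper_closureN Cp Cy' y0)|exact: xy].
  have cxy : comparable_pair C x y.
    by split; [exact: Cy'|exact: (proper_closureN Cp Cx' x0)|exact: yx].
  have Fx : face C x x.
    apply/(faceP _ Cc Cx'); split; first exact: Cx'.
    by exists 1; rewrite scale1r subrr; exact: closure_cone0.
  have Fy : face C x y by apply/(faceP _ Cc Cx'); split; [exact: Cy'|exact: xy].
  have gh : detour C b g h = _ := detour_boundary_horofunction Cc Cp Cb dx dy cyx gbus.
  have hg : detour C b h g = _ := detour_boundary_horofunction Cc Cp Cb dy dx cxy hbus.
  apply: (etrans (congr2 adde gh hg)); congr EFin.
  rewrite /hilbert /funk /rfunk.
  rewrite (Mratio_face Cc Cx' Cx' Fy Fxy).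
  rewrite (Mratio_face Cc Cx' Cy' Fx erefl).
  rewrite /base_shift.
  have real_eq (a1 a2 a3 a4 c1 c2 c3 c4 : R) :
    a1 + a2 - (c1 + c2 - (c3 + c4)) + (a3 + a4 - (c3 + c4 - (c1 + c2))) =
    a3 + a1 + (a2 + a4) by ring.
  exact: real_eq.
move=> neq.
have [gh_ge0 gh_fin] := detour_ltoo Cc Cp Cb dx dy.
have [hg_ge0 hg_fin] := detour_ltoo Cc Cp Cb dy dx.
(* Nonnegativity rules out a summand [-oo], so one infinite cost is enough. *)
have adde_oo (u v : \bar R) : (0 <= u)%E -> (0 <= v)%E -> u = +oo%E \/ v = +oo%E ->
  (u + v = +oo)%E by case: u v => [r| |] [s| |] //= _ _ [].
apply: (adde_oo _ _ gh_ge0 hg_ge0).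
have [gh_oo|/gh_fin[[_ _ xy] ST]] := eqVneq (detour C b g h) +oo%E; first by left.
have [hg_oo|/hg_fin[[_ _ yx] TS]] := eqVneq (detour C b h g) +oo%E; first by right.
case: neq; split; first exact: (proj2 facexy (conj xy yx)).
by apply/seteqP; split.
Qed.
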